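(* If $D$ is a bipartite digraph, then ${\rm ndi}(D)\le\Delta^*(D)+2$.
   Context: All digraphs are finite, without loops and without multiple arcs (opposite arcs allowed). A digraph is bipartite if its underlying simple undirected graph (obtained by replacing each arc or pair of opposite arcs by an edge) is bipartite. $\Delta^*(D)$ is the maximum of the maximum outdegree and the maximum indegree of $D$. A (proper) $k$-arc-colouring of $D$ is a map $\gamma$ from $A(D)$ to a set of $k$ colours such that arcs with the same head get distinct colours and arcs with the same tail get distinct colours. $S_\gamma^+(u)$, $S_\gamma^-(u)$ are the sets of colours on arcs with tail $u$, resp. head $u$. $\gamma$ is neighbour-distinguishing if for every arc $uv$, $(S_\gamma^+(u),S_\gamma^-(u))\neq(S_\gamma^+(v),S_\gamma^-(v))$ as ordered pairs. ${\rm ndi}(D)$ is the minimum number of colours of a neighbour-distinguishing arc-colouring of $D$. *)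

(* Defs.v *)
From mathcomp Require Import all_boot.

Set Implicit Arguments.
Unset Strict Implicit.
Unset Printing Implicit Defensive.

Record digraph := Digraph {
  vertex :> finType;
  has_arc : rel vertex;
  has_arc_irr : irreflexive has_arc
}.

Section Digraphs.
Variable D : digraph.

Definition underlying_edge : rel D := [rel u v | has_arc u v || has_arc v u].

Definition bipartite_rel (V : finType) (e : rel V) : Prop :=
  exists X : {set V}, forall u v : V, e u v -> (u \in X) != (v \in X).

Definition bipartite : Prop := bipartite_rel underlying_edge.

Definition outdeg (u : D) : nat := #|[set v : D | has_arc u v]|.
Definition indeg (u : D) : nat := #|[set v : D | has_arc v u]|.

Definition Delta_star : nat :=
  maxn (\max_(u : D) outdeg u) (\max_(u : D) indeg u).

Definition arc : finType := {e : D * D | has_arc e.1 e.2}.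
Definition arc_tail (a : arc) : D := (val a).1.
Definition arc_head (a : arc) : D := (val a).2.

Section Colouring.
Variables (k : nat) (g : {ffun arc -> 'I_k}).

Definition arc_colouring : bool :=
  [forall a : arc, forall b : arc,
     (a != b) && ((arc_head a == arc_head b) || (arc_tail a == arc_tail b)) ==> (g a != g b)].

Definition Sout (u : D) : {set 'I_k} := [set g a | a : arc & arc_tail a == u].
Definition Sin (u : D) : {set 'I_k} := [set g a | a : arc & arc_head a == u].

Definition neighbour_distinguishing : bool :=
  [forall u : D, forall v : D,
     has_arc u v ==> ((Sout u, Sin u) != (Sout v, Sin v))].

End Colouring.

Definition nd_colourable (k : nat) : bool :=
  [exists g : {ffun arc -> 'I_k},
     arc_colouring g && neighbour_distinguishing g].

(* Giving all arcs pairwise distinct colours works, so the minimum defining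
   ndi is over a nonempty set. *)
Lemma nd_colourable_ex : exists k, nd_colourable k.
Proof.
exists #|arc|; apply/existsP; exists [ffun a => enum_rank a].
apply/andP; split.
  apply/forallP=> a; apply/forallP=> b; apply/implyP=> /andP[ab _].
  by rewrite !ffunE (inj_eq enum_rank_inj).
apply/forallP=> u; apply/forallP=> v; apply/implyP=> uv.
apply/eqP=> -[SE _].
pose a : arc := exist _ (u, v) uv.
have : enum_rank a \in Sout [ffun a => enum_rank a] u.
  by apply/imsetP; exists a; rewrite ?inE ?ffunE /arc_tail //=.
rewrite SE => /imsetP[b]; rewrite inE ffunE => /eqP tb /enum_rank_inj ab.
by move: (uv); rewrite -tb -ab /arc_tail /= has_arc_irr.
Qed.

Definition ndi : nat := ex_minn nd_colourable_ex.

End Digraphs.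

(* Main.v *)
Require Import Defs.
From mathcomp Require Import all_boot.

Set Implicit Arguments.
Unset Strict Implicit.
Unset Printing Implicit Defensive.

(** By König's theorem the arcs of [D], viewed as edges of the bipartite double
    graph joining the out-copy of the tail to the in-copy of the head, can be
    properly coloured with Delta* colours.  Recolour a maximal matching of this
    double graph with two new colours, according to the side of the bipartition
    containing the tail.  By maximality, for every arc [uv] the matching has an
    arc leaving [u] or entering [v], and the new colour of that arc occurs in
    S+(u) but not in S+(v), or in S-(v) but not in S-(u). *)

(** * Edge colourings and maximal matchings in bipartite multigraphs *)

Section Koenig.

(* A bipartite multigraph: the edge [e] joins [s e] to [t e]. *)
Variables (T L R : finType) (s : T -> L) (t : T -> R).

Definition proper_at (V : finType) (h : T -> V) (E : {set T}) (c : T -> nat) :=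
  {in E &, forall e f, h e = h f -> c e = c f -> e = f}.

(** Pigeonhole: fewer than [k] edges at [v] cannot use all of [0, ..., k - 1]. *)
Lemma missing_colour (V : finType) (h : T -> V) (E : {set T}) (c : T -> nat)
    (k : nat) (v : V) :
  #|[set e in E | h e == v]| < k ->
  exists2 a, a < k & {in E, forall e, h e = v -> c e != a}.
Proof.
set A := [set e in E | _] => ltAk.
have [/allP sub|/allPn[a]] :=
  boolP (all (fun a => a \in [seq c e | e <- enum A]) (iota 0 k)).
  have := uniq_leq_size (iota_uniq 0 k) sub.
  by rewrite size_iota size_map -cardE leqNgt ltAk.
rewrite mem_iota add0n => /andP[_ ltak] aN; exists a => // e eE hev.
apply: contraNneq aN => <-; apply: map_f.
by rewrite mem_enum inE eE hev eqxx.
Qed.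

Section KempeSwap.

Variables (E : {set T}) (c : T -> nat) (a b : nat) (x : L) (y : R).
Hypothesis sP : proper_at s E c.
Hypothesis tP : proper_at t E c.
Hypothesis xNa : {in E, forall e, s e = x -> c e != a}.
Hypothesis yNb : {in E, forall e, t e = y -> c e != b}.

(** One step covers two edges of the Kempe chain: out along a [b]-edge, back along the [a]-edge with
    the same head. The chain from [x] begins with [b], since [a] is missing at [x]. *)
Definition kempe_step : rel L := fun w w' =>
  [exists e in E, exists f in E,
    [&& s e == w, c e == b, s f == w', c f == a & t e == t f]].

Let S := connect kempe_step x.

Definition swap_colour (n : nat) : nat :=
  if n == a then b else if n == b then a else n.

(** Selecting edges by tail recolours all edges at a vertex of [L] together, so only properness at
    heads needs an argument. *)
Definition kempe_swap (e : T) : nat := if S (s e) then swap_colour (c e) else c e.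

Lemma swap_colour_inj : injective swap_colour.
Proof.
by move=> m n; rewrite /swap_colour; do 4?[case: eqP => ?]; congruence.
Qed.

(** As [a] is missing at [x], the tail of [f] is reached by a genuine last step. Its [a]-edge is [f]
    by properness at tails, so its [b]-edge is the required [e]. *)
Lemma kempe_pred f : f \in E -> c f = a -> S (s f) ->
  exists2 e, e \in E & [/\ S (s e), c e = b & t e = t f].
Proof.
move=> fE cf /connectP[p]; case/lastP: p => [_ /=|p w] /=.
  by move=> /(xNa fE); rewrite cf eqxx.
rewrite rcons_path last_rcons => /andP[xp step] sf; subst w.
case/exists_inP: step => e eE /exists_inP[f' f'E].
case/and5P=> /eqP se /eqP ce /eqP sf' /eqP cf' /eqP tef.
exists e => //; split=> //; first by rewrite /S se; apply/connectP; exists p.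
by rewrite tef; congr t; apply: sP; rewrite ?cf ?cf'.
Qed.

(** This prevents clashes at heads: an [a]-edge and a [b]-edge meeting there are swapped together or
    not at all. *)
Lemma kempe_closed e f : e \in E -> f \in E -> t e = t f ->
  c e = b -> c f = a -> S (s e) = S (s f).
Proof.
move=> eE fE tef ce cf; apply/idP/idP => [Se|/(kempe_pred fE cf)].
  apply: connect_trans Se (connect1 _).
  apply/exists_inP; exists e => //; apply/exists_inP; exists f => //.
  by rewrite tef ce cf !eqxx.
case=> e' e'E [Se' ce' te'].
by have <- : e' = e by apply: tP; rewrite ?te' ?ce'.
Qed.

Lemma kempe_swap_tail : proper_at s E kempe_swap.
Proof.
move=> e f eE fE sef; rewrite /kempe_swap sef.
by case: (S _) => [/swap_colour_inj|]; apply: sP.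
Qed.

Lemma kempe_swap_head : proper_at t E kempe_swap.
Proof.
have mixed e f : e \in E -> f \in E -> t e = t f -> S (s e) -> ~~ S (s f) ->
    swap_colour (c e) = c f -> e = f.
  move=> eE fE tef Se NSf; rewrite /swap_colour.
  case: eqP => [ce cf|_]; first by rewrite (@kempe_closed f e) ?Se in NSf.
  case: eqP => [ce cf|_]; first by rewrite -(@kempe_closed e f) ?Se in NSf.
  exact: tP.
move=> e f eE fE tef; rewrite /kempe_swap.
case: ifPn => Se; case: ifPn => Sf.
- by move/swap_colour_inj; apply: tP.
- exact: mixed.
- by move=> /esym cef; apply/esym; apply: mixed.
- exact: tP.
Qed.

Lemma kempe_swap_missing_tail : {in E, forall e, s e = x -> kempe_swap e != b}.
Proof.
move=> e eE sex; rewrite /kempe_swap sex /S connect0.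
have := xNa eE sex; rewrite /swap_colour => /negbTE cea; rewrite cea.
by case: (c e =P b) => [<-|/eqP//]; rewrite eq_sym cea.
Qed.

(** The only danger is an [a]-edge at [y] with tail in [S], but the chain would have reached it
    through a [b]-edge at [y]. *)
Lemma kempe_swap_missing_head : {in E, forall e, t e = y -> kempe_swap e != b}.
Proof.
move=> e eE tey; rewrite /kempe_swap.
have ceb := yNb eE tey; case: ifPn => // Se; rewrite /swap_colour.
case: (c e =P a) => [cea|/eqP cea].
  have [f fE [_ cf tf]] := kempe_pred eE cea Se.
  by have := yNb fE; rewrite tf cf eqxx => /(_ tey).
by rewrite (negbTE ceb).
Qed.

Lemma kempe_swap_lt k e : a < k -> b < k -> c e < k -> kempe_swap e < k.
Proof. by rewrite /kempe_swap /swap_colour => *; do 3?case: ifP. Qed.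

End KempeSwap.

Lemma proper_at_extend (V : finType) (h : T -> V) (E : {set T}) c e0 b :
  proper_at h E c -> {in E, forall e, h e = h e0 -> c e != b} ->
  proper_at h (e0 |: E) (fun e => if e == e0 then b else c e).
Proof.
move=> hP bP e f; rewrite !inE.
case: (e =P e0) => [->|_]; case: (f =P e0) => [->|_] //= eE fE hef.
- by move=> cf; have := bP _ fE (esym hef); rewrite -cf eqxx.
- by move=> ce; have := bP _ eE hef; rewrite ce eqxx.
- exact: hP.
Qed.

(** Induction on the number of edges: colour all but [e0], then swap along a Kempe chain to free one
    colour at both ends of [e0]. *)
Theorem koenig_edge_colouring (k : nat) (E : {set T}) :
  (forall x, #|[set e in E | s e == x]| <= k) ->
  (forall y, #|[set e in E | t e == y]| <= k) ->
  exists c, [/\ {in E, forall e, c e < k}, proper_at s E c & proper_at t E c].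
Proof.
have [n] := ubnP #|E|; elim: n E => // n IHn E leEn degs degt.
have [->|[e0 e0E]] := set_0Vmem E.
  by exists (fun=> 0); split=> [e|e f|e f]; rewrite inE.
pose F := E :\ e0.
have sub (V : finType) (h : T -> V) v :
    [set e in F | h e == v] \subset [set e in E | h e == v].
  by apply/subsetP=> e; rewrite !inE -andbA => /and3P[_ -> ->].
have [c [ck sP tP]] : exists c,
    [/\ {in F, forall e, c e < k}, proper_at s F c & proper_at t F c].
  apply: IHn => [|v|v]; last 2 first.
  - exact: leq_trans (subset_leq_card (sub _ _ _)) (degs v).
  - exact: leq_trans (subset_leq_card (sub _ _ _)) (degt v).
  by move: leEn; rewrite (cardsD1 e0 E) e0E.
have free (V : finType) (h : T -> V) :
    (forall v, #|[set e in E | h e == v]| <= k) ->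
    #|[set e in F | h e == h e0]| < k.
  (* Strict because [e0] counts at its own end in [E] but not in [F]. *)
  move=> deg; apply: leq_trans (deg (h e0)); apply: proper_card.
  apply/properP; split=> //; exists e0; rewrite !inE ?e0E ?eqxx //.
have [a ak xNa] := missing_colour c (free _ s degs).
have [b bk yNb] := missing_colour c (free _ t degt).
(* After this swap [b] is missing at both ends of [e0], so [e0] can receive it. *)
pose c' := kempe_swap F c a b (s e0).
exists (fun e => if e == e0 then b else c' e).
rewrite -(setD1K e0E); split.
- move=> e; rewrite in_setU1; case: eqP => //= _ eF.
  exact: kempe_swap_lt (ck _ eF).
- apply: proper_at_extend; first exact: kempe_swap_tail.
  exact: kempe_swap_missing_tail.
- apply: proper_at_extend; first exact: kempe_swap_head.
  exact: kempe_swap_missing_head.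
Qed.

(** Take [M] maximal for inclusion: an edge meeting no edge of [M] could be added to it. *)
Lemma maximal_matching : exists M : {set T},
  [/\ {in M &, injective s}, {in M &, injective t}
    & forall e, exists2 f, f \in M & s f = s e \/ t f = t e].
Proof.
pose P (M : {set T}) := dinjectiveb s M && dinjectiveb t M.
have P0 : P set0 by apply/andP; split; apply/dinjectiveP=> e f; rewrite inE.
have [M /maxsetP[/andP[/dinjectiveP sM /dinjectiveP tM] maxM] _] := maxset_exists P0.
exists M; split=> // e.
have [/exists_inP[f fM /orP ef]|/exists_inPn eN] :=
  boolP [exists f in M, (s f == s e) || (t f == t e)].
  by exists f => //; case: ef => /eqP; [left|right].
have extend (V : finType) (h : T -> V) : {in M &, injective h} ->
    {in M, forall f, h f != h e} -> {in e |: M &, injective h}.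
  move=> hM hN f g; rewrite !inE.
  case: (f =P e) => [->|_]; case: (g =P e) => [->|_] //= fM gM hfg.
  - by have := hN _ gM; rewrite hfg eqxx.
  - by have := hN _ fM; rewrite hfg eqxx.
  - exact: hM.
have eM : e \in M.
  have <- : e |: M = M; last by rewrite setU11.
  apply: maxM; last exact: subsetUr.
  apply/andP; split; apply/dinjectiveP; apply: extend => // f /eN.
    by rewrite negb_or => /andP[].
  by rewrite negb_or => /andP[].
by exists e; last by left.
Qed.

End Koenig.

(** * Degrees in the bipartite double graph *)

Section ArcDegrees.

Variable D : digraph.

Lemma arc_ends_inj (e f : Defs.arc D) :
  arc_tail e = arc_tail f -> arc_head e = arc_head f -> e = f.
Proof.
rewrite /arc_tail /arc_head => te he; apply: val_inj.
by rewrite [val e]surjective_pairing te he -surjective_pairing.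
Qed.

Lemma card_arcs_from (u : D) :
  #|[set e in [set: Defs.arc D] | arc_tail e == u]| <= Delta_star D.
Proof.
apply: leq_trans (leq_maxl _ _).
apply: leq_trans (leq_bigmax u); rewrite /outdeg.
rewrite -(card_in_imset (f := @arc_head D)).
  apply/subset_leq_card/subsetP=> _ /imsetP[e eu ->].
  by move: eu; rewrite !inE => /eqP <-; exact: valP e.
by move=> e f; rewrite !inE => /eqP te /eqP tf; apply: arc_ends_inj; rewrite te tf.
Qed.

Lemma card_arcs_to (u : D) :
  #|[set e in [set: Defs.arc D] | arc_head e == u]| <= Delta_star D.
Proof.
apply: leq_trans (leq_maxr _ _).
apply: leq_trans (leq_bigmax u); rewrite /indeg.
rewrite -(card_in_imset (f := @arc_tail D)).
  apply/subset_leq_card/subsetP=> _ /imsetP[e eu ->].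
  by move: eu; rewrite !inE => /eqP <-; exact: valP e.
by move=> e f; rewrite !inE => /eqP he /eqP hf te; apply: arc_ends_inj; rewrite // he hf.
Qed.

End ArcDegrees.

(** * Recolouring the matching and bounding [ndi] *)

Unset Implicit Arguments.

Theorem theorem8 (D : digraph) (hD : bipartite D) : ndi D <= Delta_star D + 2.
Proof.
(* By minimality it suffices to exhibit one suitable colouring with [Delta_star D + 2] colours. *)
rewrite /ndi; case: ex_minnP => m _; apply.
case: hD => X /= hX; set k := Delta_star D.
have sides (e : Defs.arc D) : (arc_tail e \in X) != (arc_head e \in X).
  by apply: hX; apply/orP; left; exact: valP e.
have [c [ck sP tP]] :=
  koenig_edge_colouring (@card_arcs_from D) (@card_arcs_to D).
have [M [sM tM maxM]] := maximal_matching (@arc_tail D) (@arc_head D).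
pose g (e : Defs.arc D) := if e \in M then k + (arc_tail e \in X) else c e.
have gk e : g e < k + 2.
  rewrite /g; case: ifP => _; first by rewrite ltn_add2l; case: (_ \in X).
  by apply: leq_trans (ck e _) (leq_addr _ _); rewrite inE.
(* Old colours are below [k], so a colour [k] or [k + 1] reveals both membership in [M] and the side
   of the tail. *)
have gM e f : f \in M -> g e = g f ->
    e \in M /\ (arc_tail e \in X) = (arc_tail f \in X).
  rewrite /g => ->; case: ifP => _ /eqP.
    by rewrite eqn_add2l; do 2!case: (_ \in X).
  by move=> /eqP ce; have := ck e (in_setT _); rewrite ce ltnNge leq_addr.
have g_proper (h : Defs.arc D -> D) : {in M &, injective h} ->
    proper_at h [set: Defs.arc D] c -> forall e f, h e = h f -> g e = g f -> e = f.
  move=> hM hP e f hef gef.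
  have [fM|fNM] := boolP (f \in M).
    by have [eM _] := gM _ _ fM gef; apply: hM.
  have [eM|eNM] := boolP (e \in M).
    by have [fM _] := gM _ _ eM (esym gef); rewrite fM in fNM.
  by move: gef; rewrite /g (negbTE eNM) (negbTE fNM); apply: hP; rewrite ?inE.
apply/existsP; exists [ffun e => Ordinal (gk e)]; apply/andP; split.
  apply/forallP=> e; apply/forallP=> f; apply/implyP=> /andP[ef adj].
  rewrite !ffunE -val_eqE /=; apply: contra ef => /eqP gef; apply/eqP.
  by case/orP: adj => /eqP; [move/(g_proper _ tM tP)|move/(g_proper _ sM sP)]; apply.
apply/forallP=> u; apply/forallP=> v; apply/implyP=> uv; apply/eqP=> -[eqout eqin].
have uvX : (u \in X) != (v \in X) by apply: hX; apply/orP; left.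
have [f fM [/= tf|/= hf]] := maxM (exist _ (u, v) uv).
- have : Ordinal (gk f) \in Sout [ffun e => Ordinal (gk e)] u.
    by apply/imsetP; exists f; rewrite ?inE ?ffunE // tf.
  (* An arc [e] leaving [v] with the colour of [f] would put [v] on the side of [u]. *)
  rewrite eqout => /imsetP[e]; rewrite inE ffunE => /eqP te [/esym/(gM _ _ fM)[_]].
  by rewrite te tf => /eqP; rewrite eq_sym (negbTE uvX).
- have : Ordinal (gk f) \in Sin [ffun e => Ordinal (gk e)] v.
    by apply/imsetP; exists f; rewrite ?inE ?ffunE // hf.
  rewrite -eqin => /imsetP[e]; rewrite inE ffunE => /eqP he [/esym/(gM _ _ fM)[_]].
  (* The tail of [f] lies opposite [v] and that of [e] opposite [u], so the two tails are on
     different sides. *)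
  have := sides e; have := sides f; rewrite he hf /arc_head /=; move: uvX.
  by do 4!case: (_ \in X).
Qed.
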